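(* Let $G$ be a group and let $V$ be a finite-dimensional vector space over $\mathbb{F}$. Then, $\mathrm{LCA}(G;V)$ is vN-regular if and only if $G$ is locally finite and $\mathrm{char}(\mathbb{F}) \nmid o(g)$, for all $g \in G$.
   Context: Here $\mathbb{F}$ is a field. Functions are applied on the right, and $\tau\sigma$ means first $\tau$, then $\sigma$. For a group $G$ and a set $A$, $G$ acts on $A^G$ (the set of all functions $G\to A$) by $(h)(x\cdot g) := (hg^{-1})x$. A cellular automaton over $A^G$ is a map $\tau : A^G \to A^G$ for which there exist a finite subset $S \subseteq G$ and a function $\mu : A^S \to A$ such that $(g)(x)\tau = ((x\cdot g^{-1})|_S)\mu$ for all $x\in A^G$, $g\in G$; $\mathrm{CA}(G;A)$ is the monoid of all of them under composition. For a vector space $V$ over $\mathbb{F}$, $V^G$ is a vector space over $\mathbb{F}$ with pointwise operations, $\mathrm{End}_{\mathbb{F}}(V^G)$ is the set of all $\mathbb{F}$-linear maps $V^G\to V^G$, and $\mathrm{LCA}(G;V)=\mathrm{CA}(G;V)\cap \mathrm{End}_{\mathbb{F}}(V^G)$ is the monoid (under composition) of all $\mathbb{F}$-linear cellular automata over $V^G$. $\mathrm{LCA}(G;V)$ is vN-regular (von Neumann regular) if for every $\tau\in\mathrm{LCA}(G;V)$ there exists $\sigma\in\mathrm{LCA}(G;V)$ with $\tau\sigma\tau=\tau$. A group is locally finite if every finitely generated subgroup is finite. $o(g) := |\langle g\rangle|$ is the order of $g$. The characteristic $\mathrm{char}(\mathbb{F})$ is the smallest positive integer $k$ such that the sum of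 $k$ copies of the multiplicative identity of $\mathbb{F}$ is $0$, and it is $0$ if no such $k$ exists (characteristic $0$ divides no positive integer).
   Formalization: The vector space V is additionally assumed to be nonzero; for V = 0 and G the infinite cyclic group, LCA(G;V) is trivial and hence vN-regular although G is not locally finite, so the statement fails there. *)

(* Defs.v *)
From HB Require Import structures.
From mathcomp Require Import all_boot all_order all_algebra.
From mathcomp Require Import finmap.
From mathcomp Require Import boolp classical_sets functions cardinality.

Set Implicit Arguments.
Unset Strict Implicit.
Unset Printing Implicit Defensive.

Import GRing.Theory.

Local Open Scope classical_set_scope.

Section CellularAutomata.
Variables (G : groupType) (A : Type).

Definition shift (x : G -> A) (g : G) : G -> A := fun h => x (h * g^-1)%g.

Definition is_CA (tau : (G -> A) -> (G -> A)) : Prop :=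
  exists (S : {fset G}) (mu : (S -> A) -> A),
    forall (x : G -> A) (g : G),
      tau x g = mu (fun s : S => shift x g^-1%g (val s)).

Definition CA : set ((G -> A) -> (G -> A)) := [set tau | is_CA tau].

End CellularAutomata.
Arguments CA G A : clear implicits.

(* (G -> V) carries the pointwise vector space structure. *)
Definition LCA (G : groupType) (F : fieldType) (V : vectType F) :
    set ((G -> V) -> (G -> V)) :=
  CA G V `&` [set tau : (G -> V) -> (G -> V) | linear tau].
Arguments LCA G {F} V.

(* Maps are composed left to right: (f \; g) applies f first, then g. *)
Definition vN_regular (T : Type) (M : set (T -> T)) : Prop :=
  forall tau, M tau -> exists2 sigma, M sigma & tau \; sigma \; tau = tau.

Section Groups.
Variable G : groupType.

Definition generated (X : set G) : set G :=
  smallest [set H : set G | group_closed (mem H)] X.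

Definition locally_finite : Prop :=
  forall X : set G, finite_set X -> finite_set (generated X).

(* |<g>| = n; no n satisfies this when g has infinite order. *)
Definition has_order (g : G) (n : nat) : Prop :=
  (generated [set g] #= `I_n)%card.

End Groups.

(* Unlike [pchar F], this is a number, with value 0 in characteristic zero;
   since 0 divides only 0, it then divides no order of an element. *)
Definition characteristic (F : fieldType) : nat :=
  if pselect (exists k, (0 < k)%N && (k%:R == 0 :> F)%R) is left ex_k
  then ex_minn ex_k else 0.

(* Main.v *)
(** If LCA(G;V) is vN-regular and g_1, ..., g_n generate H, quasi-inverses yield
    a cellular automaton phi that fixes constant configurations and satisfies
    phi g_i = phi for all i.  Its coefficients are then constant on the cosets
    Hg and finitely many are nonzero, so H is finite; and for H = <g> a constant
    v equals o(g) times a vector, so o(g) is invertible in F.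

    Conversely, if a memory set of tau generates a finite subgroup H, then tau
    restricts to an H-equivariant endomorphism T of V^H.  A linear
    quasi-inverse Q of T can be averaged over H, as |H| is invertible in F by
    Cauchy's theorem: since T commutes with H, the average is still a
    quasi-inverse, and being equivariant it is given by a local rule on G. *)

From mathcomp Require Import fingroup pgroup.
Require Import Defs.
From HB Require Import structures.
From mathcomp Require Import all_boot all_algebra.
From mathcomp Require Import finmap.
From mathcomp Require Import boolp classical_sets functions cardinality.

Set Implicit Arguments.
Unset Strict Implicit.
Unset Printing Implicit Defensive.

Import GRing.Theory.

Local Open Scope classical_set_scope.
Local Open Scope ring_scope.

(** * The characteristic and generated subgroups *)

Lemma dvdn_characteristic (F : fieldType) (n : nat) :
  (characteristic F %| n)%N = (n%:R == 0 :> F).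
Proof.
rewrite /characteristic; case: pselect => [ex_k | no_k]; last first.
  rewrite dvd0n; apply/eqP/eqP => [-> //| n0]; apply/eqP.
  by apply: contra_notT no_k; rewrite -lt0n => ?; exists n; rewrite n0 eqxx andbT.
case: ex_minnP => k /andP[k_gt0 /eqP k0] k_min.
rewrite {2}(divn_eq n k) natrD natrM k0 mulr0 add0r /dvdn.
apply/eqP/eqP => [-> //| r0]; apply/eqP; apply: contraT; rewrite -lt0n => r_gt0.
by have := k_min (n %% k)%N; rewrite r_gt0 r0 eqxx leqNgt ltn_pmod // => /(_ isT).
Qed.

Lemma generated_closed (G : groupType) (X : set G) :
  group_closed (mem (generated X)).
Proof.
split=> [|u v]; rewrite !inE.
  by move=> H [[H1 _] _]; move: H1; rewrite inE.
move=> Xu Xv H HX; have [[_ divH] _] := HX.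
by have := divH u v; rewrite !inE; apply; [apply: Xu | apply: Xv].
Qed.

Lemma generated1 (G : groupType) (X : set G) : generated X 1%g.
Proof. by have [] := generated_closed X; rewrite inE. Qed.

Lemma generatedM (G : groupType) (X : set G) (u v : G) :
  generated X u -> generated X v -> generated X (u * v)%g.
Proof.
move=> Xu Xv; have /group_closedM/(_ u v) := generated_closed X.
by rewrite !inE; apply.
Qed.

Lemma generatedV (G : groupType) (X : set G) (u : G) :
  generated X u -> generated X u^-1%g.
Proof.
move=> Xu; have /group_closedV/(_ u) := generated_closed X.
by rewrite !inE; apply.
Qed.

Lemma sum_if_eq (I : eqType) (M : nmodType) (r : seq I) (j : I) (v : M) :
  uniq r -> \sum_(i <- r) (if i == j then v else 0) = if j \in r then v else 0.
Proof.
move=> r_uniq; case: ifP => [jr | /negP jr].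
  rewrite (bigD1_seq j) //= eqxx big1 ?addr0 // => i /negPf -> //.
by rewrite big_seq big1 // => i ir; case: eqP => // ij; rewrite -ij in jr.
Qed.

(** * Cellular automata as local maps *)

Section Local.
Variables (G : groupType) (A : Type).

(** Comparing two configurations at two different points packs finite memory and shift-equivariance
    into one condition, without naming a local rule. *)
Definition local_map (S : {fset G}) (tau : (G -> A) -> G -> A) :=
  forall (x y : G -> A) (g h : G),
    {in S, forall s, x (s * g)%g = y (s * h)%g} -> tau x g = tau y h.

Lemma CA_local tau (a : A) : CA G A tau <-> exists S, local_map S tau.
Proof.
split=> [[S [mu tauE]] | [S tauS]]; exists S.
  move=> x y g h xy; rewrite !tauE; congr mu.
  by apply/funext => s; rewrite /shift !invgK xy // fsvalP.
(* The local rule is read off at the identity, after a pattern on [S] is extended by the default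
   letter [a]. *)
exists (fun z => tau (fun g => oapp z a (insub g)) 1%g) => x g.
apply: tauS => s sS.
by rewrite mulg1 insubT /= /shift !invgK.
Qed.

End Local.

(** * Linear cellular automata and the necessity of both conditions *)

Section LinearCA.
Variables (G : groupType) (F : fieldType) (V : vectType F).
Implicit Types (tau sigma : (G -> V) -> G -> V) (x : G -> V) (v : V).

Lemma LCA_local tau :
  LCA G V tau <-> linear tau /\ exists S, local_map S tau.
Proof.
split=> -[tauC tauL]; split=> //; first exact/(CA_local tau 0).
exact/(CA_local tau 0).
Qed.

Lemma LCA_linear tau : LCA G V tau -> linear tau. Proof. by case. Qed.

Lemma LCA_id : LCA G V id.
Proof.
apply/LCA_local; split=> //; exists [fset 1%g]%fset => x y g h xy.
by have := xy 1%g; rewrite !inE !mul1g; apply.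
Qed.

Lemma LCA_comp tau sigma : LCA G V tau -> LCA G V sigma -> LCA G V (tau \o sigma).
Proof.
move=> /LCA_local[tauL [S tauS]] /LCA_local[sigmaL [T sigmaT]].
apply/LCA_local; split; first by move=> a x y /=; rewrite sigmaL tauL.
exists [fset (t * s)%g | t in T, s in S]%fset => x y g h xy /=.
apply: tauS => s sS; apply: sigmaT => t tT; rewrite !mulgA.
by apply: xy; apply: in_imfset2.
Qed.

Lemma LCA_sub tau sigma : LCA G V tau -> LCA G V sigma -> LCA G V (tau \- sigma).
Proof.
move=> /LCA_local[tauL [S tauS]] /LCA_local[sigmaL [T sigmaT]].
apply/LCA_local; split.
  move=> a x y; apply/funext => g /=.
  by rewrite /= tauL sigmaL scalerBr addrACA opprD.
exists (S `|` T)%fset => x y g h xy /=.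
congr (_ - _); [apply: tauS | apply: sigmaT] => s sS; apply: xy;
  by rewrite inE sS ?orbT.
Qed.

(** Multiplication is on the side opposite to [shift], so this is itself a cellular automaton, with
    memory set {g}. *)
Definition translate (g : G) x : G -> V := fun h => x (g * h)%g.

Lemma LCA_translate g : LCA G V (translate g).
Proof.
apply/LCA_local; split=> //; exists [fset g]%fset => x y h k xy.
by apply: xy; rewrite inE.
Qed.

Lemma LCA_const tau v : LCA G V tau ->
  tau (fun=> v) = fun=> tau (fun=> v) 1%g.
Proof. by case/LCA_local=> _ [S tauS]; apply/funext => g; apply: tauS. Qed.

Lemma LCA_sum tau (I : Type) (r : seq I) (P : pred I) (E : I -> G -> V) :
  LCA G V tau -> tau (\sum_(i <- r | P i) E i) = \sum_(i <- r | P i) tau (E i).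
Proof.
move=> /LCA_linear tauL.
pose f : {linear (G -> V) -> (G -> V)} :=
  HB.pack tau (GRing.isLinear.Build _ _ _ _ tau tauL).
exact: (linear_sum f).
Qed.

Lemma LCA_diff tau x y : LCA G V tau -> tau (x - y) = tau x - tau y.
Proof.
by move=> /LCA_linear tauL; rewrite addrC -scaleN1r tauL scaleN1r addrC.
Qed.

Lemma LCA0 tau : LCA G V tau -> tau 0 = 0.
Proof. by move=> tauL; rewrite -[X in tau X](subrr 0) LCA_diff // subrr. Qed.


(* Each new element g is handled by a quasi-inverse of tau = phi o (g - 1):
   replacing phi by (1 - tau sigma) phi makes it vanish on the image of g - 1,
   and constants are preserved because tau kills them. *)
Lemma LCA_invariant (s : seq G) : vN_regular (LCA G V) ->
  exists phi, [/\ LCA G V phi, forall v, phi (fun=> v) = (fun=> v) &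
    forall g, g \in s -> forall x, phi (translate g x) = phi x].
Proof.
move=> reg; elim: s => [|g s [phi [phiL phi_cst phi_s]]].
  by exists id; split=> //; exact: LCA_id.
pose tau := phi \o (translate g \- id).
have tauL : LCA G V tau.
  by apply: LCA_comp phiL _; apply: LCA_sub (LCA_translate _) LCA_id.
have tau_cst v : tau (fun=> v) = 0.
  rewrite /tau /=; set z := (X in phi X); suff -> : z = 0 by exact: LCA0.
  by apply/funext => h; rewrite /z /= /translate subrr.
have [sigma sigmaL tau_reg] := reg tau tauL.
have compL : LCA G V (tau \o sigma) by apply: LCA_comp.
exists (phi \- (tau \o sigma \o phi)); split.
- by apply: LCA_sub => //; apply: LCA_comp.
- move=> v; apply/funext => h /=.
  by rewrite phi_cst (LCA_const v sigmaL) tau_cst subr0.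
move=> h; rewrite inE => /orP[/eqP -> | hs] x; last first.
  by apply/funext => k /=; rewrite phi_s.
have tauE : tau x = phi (translate g x) - phi x by rewrite /tau /= -LCA_diff.
have tauB y z : tau (sigma (y - z)) = tau (sigma y) - tau (sigma z).
  exact: (LCA_diff _ _ compL).
apply/eqP; rewrite -subr_eq0; apply/eqP.
transitivity (tau x - tau (sigma (tau x))).
  rewrite [in RHS]tauE tauB.
  apply/funext => k; rewrite !fctE /= !opprB [LHS]addrACA [RHS]addrACA.
  by congr (_ + _); exact: addrC.
have /= -> := congr1 (@^~ x) tau_reg.
exact: subrr.
Qed.

(** The elements under whose translation [phi] is invariant form a subgroup, so invariance passes
    from generators to everything they generate. *)
Lemma LCA_invariant_generated (s : seq G) : vN_regular (LCA G V) ->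
  exists phi, [/\ LCA G V phi, forall v, phi (fun=> v) = (fun=> v) &
    forall g, generated [set` s] g -> forall x, phi (translate g x) = phi x].
Proof.
move=> /(LCA_invariant s) [phi [phiL phi_cst phi_s]]; exists phi; split=> //.
apply: smallest_sub => //; split.
  by rewrite inE => x; congr phi; apply/funext => h; rewrite /translate mul1g.
move=> u v; rewrite !inE => phi_u phi_v x.
rewrite -[RHS]phi_u -[LHS]phi_v; congr phi.
by apply/funext => h; rewrite /translate -!mulgA mulKg.
Qed.

(** The values [phi (delta t) 1] act as coefficients of [phi]: they vanish for t outside [S] and are
    constant along Ht by invariance. One nonzero value therefore puts Ht inside [S]. *)
Lemma vN_regular_locally_finite : (0 < \dim {:V})%N ->
  vN_regular (LCA G V) -> locally_finite G.
Proof.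
move=> V_gt0 reg X /finite_seqP[s ->{X}].
have [phi [phiL phi_cst phi_inv]] := LCA_invariant_generated s reg.
have [v v0] : exists v : V, v != 0.
  by exists (vpick {:V}); rewrite vpick0 -dimv_eq0 -lt0n.
have [_ [S phiS]] := (LCA_local phi).1 phiL.
pose delta g : G -> V := fun h => if h == g then v else 0.
have [t phi_t] : exists t, phi (delta t) 1%g != 0.
  (* On [S] the constant v agrees with the finite sum of the [delta t], so if all coefficients
     vanished, v would be 0. *)
  apply: contrapT => no_t; move/eqP: v0; apply.
  rewrite -[v]/((fun=> v) (1%g : G)) -phi_cst.
  transitivity (phi (\sum_(t <- S) delta t) 1%g).
    apply: phiS => t tS; rewrite mulg1 fct_sumE /delta.
    by under eq_bigr do rewrite eq_sym; rewrite sum_if_eq ?fset_uniq // tS.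
  rewrite LCA_sum // fct_sumE big1 // => t _.
  by apply/eqP; apply: contra_notT no_t => ?; exists t.
apply: (sub_finite_set (B := (fun h => h * t^-1)%g @` [set` S])); last first.
  exact/finite_image.
move=> h Hh; exists (h * t)%g; last by rewrite mulgK.
apply: contraNT phi_t => ht_S.
have -> : phi (delta t) = phi (delta (h * t)%g).
  rewrite -[RHS](phi_inv h) //; congr phi; apply/funext => k.
  by rewrite /delta /translate (inj_eq (mulgI h)).
have -> : phi (delta (h * t)%g) 1%g = phi 0 1%g; last by rewrite LCA0.
apply: phiS => k kS; rewrite mulg1 /delta.
by case: eqP => // kht; rewrite -kht kS in ht_S.
Qed.

(* A constant configuration is the sum, over the finite subgroup <g>, of the
   translates of a configuration supported on a transversal; an invariant phi
   therefore sends it to a multiple of the order of g. *)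
Lemma vN_regular_order : (0 < \dim {:V})%N -> vN_regular (LCA G V) ->
  forall (g : G) (n : nat), has_order g n -> n%:R != 0 :> F.
Proof.
move=> V_gt0 reg g n ordg; apply/negP => /eqP n0.
have [phi [phiL phi_cst phi_inv]] := LCA_invariant_generated [:: g] reg.
have [v v0] : exists v : V, v != 0.
  by exists (vpick {:V}); rewrite vpick0 -dimv_eq0 -lt0n.
have finH : finite_set (generated [set g]) by apply/finite_setP; exists n.
set H := generated [set g] in ordg finH *.
have HE : generated [set` [:: g]] = H by rewrite set_cons1.
rewrite {}HE in phi_inv.
pose orb k := [set t | exists2 h, H h & t = (h * k)%g].
(* The choice depends only on the set [orb k], hence is constant on the coset Hk; the default 1 is
   never reached, since k lies in [orb k]. *)
pose rep k := xget 1%g (orb k).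
have repM h k : H h -> rep (h * k)%g = rep k.
  move=> Hh; rewrite /rep; congr xget; apply/seteqP; split=> t [u Hu ->].
    by exists (u * h)%g; [apply: generatedM | rewrite mulgA].
  exists (u * h^-1)%g; last by rewrite mulgA mulgKV.
  by apply: generatedM => //; apply: generatedV.
pose x0 : G -> V := fun k => if rep k == k then v else 0.
move/eqP: v0; apply; rewrite -[v]/((fun=> v) (1%g : G)) -phi_cst.
have -> : (fun=> v) = \sum_(h <- fset_set H) translate h x0.
  apply/funext => k; rewrite fct_sumE /translate /x0.
  have [h0 Hh0 repk] : orb k (rep k).
    apply: (xgetI 1%g (_ : orb k k)).
    by exists 1%g; rewrite ?mul1g //; exact: generated1.
  (* Exactly one h, namely [h0], moves k to the representative of its coset. *)
  transitivity (\sum_(h <- fset_set H) (if h == h0 then v else 0)).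
    by rewrite sum_if_eq ?fset_uniq // in_fset_set // mem_set.
  rewrite !big_seq; apply: eq_bigr => h.
  rewrite in_fset_set // inE => Hh.
  by rewrite repM // repk (inj_eq (mulIg k)) eq_sym.
rewrite LCA_sum // big_seq.
rewrite (eq_bigr (fun=> phi x0)) => [|h]; last first.
  by rewrite in_fset_set // inE => /phi_inv.
rewrite -big_seq big_const_seq count_predT iter_addr_0 (card_fset_set ordg).
by rewrite -scaler_nat n0 scale0r.
Qed.

End LinearCA.

(** * Averaged quasi-inverses when the memory lies in a finite subgroup *)

Section FiniteMemory.
Variables (G : groupType) (F : fieldType) (V : vectType F).
Variables (H : finGroupType) (f : H -> G).
Hypotheses (fM : {morph f : h k / (h * k)%g}) (f_inj : injective f).

Let f1 : f 1%g = 1%g.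
Proof. by apply: (mulgI (f 1%g)); rewrite -fM !mulg1. Qed.

Definition extend (y : {ffun H -> V}) : G -> V :=
  fun g => oapp y 0 [pick h | f h == g].

(** Coordinates on the coset f(H)g with base point g; moving the base point to [f k * g] translates
    them by k. *)
Definition restrict (g : G) (x : G -> V) : {ffun H -> V} :=
  [ffun h => x (f h * g)%g].

Lemma extendE y h : extend y (f h) = y h.
Proof.
rewrite /extend; case: pickP => [k /eqP/f_inj -> // | /(_ h)].
by rewrite eqxx.
Qed.

Lemma extend_linear : linear extend.
Proof.
move=> a y z; apply/funext => g.
rewrite -[RHS]/(a *: extend y g + extend z g) /extend.
case: pickP => [h _ | _] /=; first by rewrite !ffunE.
by rewrite scaler0 addr0.
Qed.

Lemma LCA_quasi_inverse (S : {fset G}) (tau : (G -> V) -> G -> V) :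
    (forall s, s \in S -> exists h, f h = s) -> local_map S tau ->
    LCA G V tau -> #|H|%:R != 0 :> F ->
  exists2 sigma, LCA G V sigma & tau \; sigma \; tau = tau.
Proof.
move=> S_H tauS tauL cardH.
pose T (y : {ffun H -> V}) : {ffun H -> V} := [ffun h => tau (extend y) (f h)].
have T_lin : linear T.
  move=> a y z; apply/ffunP => h.
  by rewrite !ffunE extend_linear (LCA_linear tauL).
pose T' : {linear {ffun H -> V} -> {ffun H -> V}} :=
  HB.pack T (GRing.isLinear.Build _ _ _ _ T T_lin).
pose Q := ((linfun T')^-1)%VF.
have TQT y : T (Q (T y)) = T y.
  by have /lfunP/(_ y) := inv_lfun_def (linfun T'); rewrite !comp_lfunE !lfunE.
have T_restrict g x h : T (restrict g x) h = tau x (f h * g)%g.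
  rewrite ffunE; apply: tauS => s /S_H[k <-].
  by rewrite -fM extendE ffunE fM mulgA.
(* In coordinates based at [f k * g], the point g has index [k^-1]; each summand proposes a value at
   g, and averaging over k removes the dependence on the base point. *)
pose sigma x g := #|H|%:R^-1 *: \sum_(k : H) Q (restrict (f k * g)%g x) k^-1%g.
have sigma_lin : linear sigma.
  move=> a x y; apply/funext => g; rewrite -[RHS]/(a *: sigma x g + sigma y g) /sigma.
  rewrite scalerA mulrC -scalerA -scalerDr; congr (_ *: _).
  rewrite scaler_sumr -big_split /=; apply: eq_bigr => k _.
  have -> : restrict (f k * g)%g (a *: x + y) =
      a *: restrict (f k * g)%g x + restrict (f k * g)%g y.
    by apply/ffunP => h; rewrite !ffunE.
  by rewrite linearP !ffunE.
have sigmaL : LCA G V sigma.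
  apply/LCA_local; split=> //; exists [fset f h | h in H]%fset => x y g g' xy.
  congr (_ *: _); apply: eq_bigr => k _.
  congr (fun_of_fin (Q _) _); apply/ffunP => h; rewrite !ffunE !mulgA -fM.
  by apply: xy; rewrite in_imfset.
exists sigma => //; apply/funext => x; apply/funext => g /=.
(* Reindexing by [k * h^-1] lets all points of the coset share the base points [f k * g]. *)
have sigma_shift z h :
    sigma z (f h * g)%g =
    #|H|%:R^-1 *: \sum_k Q (restrict (f k * g)%g z) (h * k^-1)%g.
  congr (_ *: _); rewrite (reindex_inj (mulIg h^-1%g)) /=.
  by apply: eq_bigr => k _; rewrite mulgA -fM mulgKV invMg invgK.
transitivity (T (restrict g (sigma (tau x))) 1%g).
  by rewrite T_restrict f1 mul1g.
have restrict_tau k : restrict (f k * g)%g (tau x) = T (restrict (f k * g)%g x).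
  by apply/ffunP => h; rewrite T_restrict ffunE.
(* [R] is translation by H on V^H; [T] commutes with it because it comes from [tau]. *)
pose R k (y : {ffun H -> V}) : {ffun H -> V} := [ffun h => y (h * k^-1)%g].
have TR k y h : T (R k y) h = T y (h * k^-1)%g.
  have -> : R k y = restrict (f k^-1%g) (extend y).
    by apply/ffunP => u; rewrite !ffunE -fM extendE.
  by rewrite T_restrict -fM ffunE.
have -> : restrict g (sigma (tau x)) =
    #|H|%:R^-1 *: \sum_k R k (Q (T (restrict (f k * g)%g x))).
  apply/ffunP => h; rewrite ffunE sigma_shift ffunE sum_ffunE.
  by congr (_ *: _); apply: eq_bigr => k _; rewrite ffunE restrict_tau.
rewrite -[T _]/(T' _) linearZ linear_sum /= ffunE sum_ffunE.
(* By [TR] and [TQT] every summand equals [tau x g], so the factor [#|H|^-1] cancels their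
   number. *)
rewrite (eq_bigr (fun=> tau x g)) => [|k _]; last first.
  by rewrite TR TQT T_restrict mul1g mulgA -fM mulVg f1 mul1g.
by rewrite sumr_const -scaler_nat scalerA mulVf // scale1r.
Qed.

(** If |H| vanished in F, Cauchy's theorem would give an element of H of order p, the
    characteristic; the injection [f] preserves its order. *)
Lemma card_unit_of_orders :
    (forall (g : G) n, has_order g n -> n%:R != 0 :> F) -> #|H|%:R != 0 :> F.
Proof.
move=> ord; apply/negP => H0.
have H_gt0 : (0 < #|H|)%N by apply/card_gt0P; exists 1%g.
have [p charp] := natf0_pchar H_gt0 H0.
have [h _ ordh] : {h : H | h \in [set: H]%G & #[h]%g = p}.
  by apply: Cauchy (pcharf_prime charp) _; rewrite cardsT (dvdn_pcharf charp).
suff : has_order (f h) p by move/ord; rewrite -(dvdn_pcharf charp) dvdnn.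
have fX n : f (h ^+ n)%g = (f h ^+ n)%g.
  by elim: n => [|n IHn]; rewrite ?expg0 ?f1 // !expgS fM IHn.
have fV k : f k^-1%g = (f k)^-1%g.
  by apply: (mulgI (f k)); rewrite -fM !mulgV f1.
have -> : p = #|` [fset f k | k in <[h]>%g]%fset|.
  by rewrite card_imfset //= -cardE -ordh.
suff genE : generated [set f h] = [set` [fset f k | k in <[h]>%g]%fset].
  by rewrite /has_order genE; apply/card_eq_fsetP.
apply/seteqP; split.
  apply: smallest_sub => [|_ ->]; last first.
    by rewrite /= in_imfset //= cycle_id.
  split; first by rewrite inE /= -f1 in_imfset //= group1.
  move=> u v; rewrite !inE /= => /imfsetP[k /= kh ->] /imfsetP[l /= lh ->].
  by rewrite -fV -fM in_imfset //= groupM ?groupV.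
move=> _ /= /imfsetP[k /= /cycleP[n ->] ->]; rewrite fX.
elim: n => [|n IHn]; first exact: generated1.
by rewrite expgS; apply: generatedM => //; apply: sub_gen_smallest.
Qed.

End FiniteMemory.

(** * A finite subgroup as a finite group type *)

Section FiniteSubgroup.
Variables (G : groupType) (K : {fset G}).

(** The closure proof is a parameter of the type so that the group instance can be recovered from
    it. *)
Definition fset_group of group_closed (mem K) : Type := K.

Variable K_closed : group_closed (mem K).

HB.instance Definition _ := SubFinite.on (fset_group K_closed).
HB.instance Definition _ :=
  SubChoice_isSubGroup.Build G (mem K) (fset_group K_closed) K_closed.

End FiniteSubgroup.

Theorem theorem8 (G : groupType) (F : fieldType) (V : vectType F)
    (V_neq0 : (0 < \dim {:V})%N) :
  vN_regular (LCA G V) <->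
  (locally_finite G /\
   forall (g : G) (n : nat), has_order g n -> ~~ (characteristic F %| n)%N).
Proof.
split=> [reg | [lf ord] tau tauL].
  split=> [|g n]; first exact: vN_regular_locally_finite V_neq0 reg.
  by rewrite dvdn_characteristic; apply: vN_regular_order V_neq0 reg g n.
have [_ [S tauS]] := (LCA_local tau).1 tauL.
have finH : finite_set (generated [set` S]) by exact: lf.
have K_closed : group_closed (mem (fset_set (generated [set` S]))).
  have [H1 HB] := generated_closed [set` S].
  split=> [|u v]; first by rewrite in_fset_set.
  by rewrite !in_fset_set //; apply: HB.
(* The embedding is the inclusion of the subgroup generated by the memory set, finite by [lf]. *)
pose f (k : fset_group K_closed) : G := val k.
have fM : {morph f : h k / (h * k)%g} by [].
have f_inj : injective f by exact: val_inj.
apply: (LCA_quasi_inverse fM f_inj _ tauS) => // [s sS|].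
  have sK : s \in fset_set (generated [set` S]).
    by rewrite in_fset_set // inE; apply: sub_gen_smallest.
  by exists ([` sK]%fset).
apply: card_unit_of_orders fM f_inj _ => g n /ord.
by rewrite dvdn_characteristic.
Qed.
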